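(* Let $(\mathbb{X},d_{\mathbb{X}})$ and $(\mathbb{Y},\|\cdot\|_2)$ be two Polish spaces, where $\mathbb{Y}\subseteq\mathbb{R}^k$ ($k\ge 1$) carries the Euclidean metric. Let $X$ be a random variable taking values in $\mathbb{X}$ with law $\nu$, where $\nu\in\mathbb{P}_1(\mathbb{X})$ is a Borel probability measure on $(\mathbb{X},d_{\mathbb{X}})$, and let $\sigma>0$. Suppose that $$W_1(\mu,\nu)\le\sqrt{2\sigma^2 D(\mu\|\nu)}\qquad\text{for all }\mu\in\mathbb{P}_1(\mathbb{X}).$$ Let $p\ge 1$, $p\ne 2$. Then for every $\epsilon>0$, every $\varepsilon\in(0,1]$, and every Lipschitz map $f:(\mathbb{X},d_{\mathbb{X}})\to(\mathbb{Y},\|\cdot\|_2)$ with Lipschitz constant $\|f\|_{\rm Lip}>0$ (with respect to $d_{\mathbb{X}}$ and $\|\cdot\|_2$) and with $\|E_\nu[f]\|_\infty<\infty$, $$P\big(\|f(X)-E_\nu[f(X)]\|_p\ge\epsilon\big)\le\min\left\{\left(1+\frac{2}{\varepsilon}\right)^k e^{-\frac{\epsilon^2(1-\varepsilon)^2}{2\tau_p^2\sigma^2\|f\|_{\rm Lip}^2}},\ 2^{\frac{k}{2}}e^{-\frac{\epsilon^2}{4\sigma^2\tau_p^2\|f\|_{\rm Lip}^2}}\right\},$$ where $$\tau_p=\sup_{y\in f(\mathbb{X}),\ y\ne E_\nu[f(X)]}\frac{\|y-E_\nu[f(X)]\|_p}{\|y-E_\nu[f(X)]\|_2}.$$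
   Context: A map $f:\mathbb{X}\to\mathbb{Y}$ is Lipschitz with Lipschitz constant $\|f\|_{\rm Lip}$ if $\|f(x)-f(\tilde x)\|_2\le\|f\|_{\rm Lip}\,d_{\mathbb{X}}(x,\tilde x)$ for all $x,\tilde x\in\mathbb{X}$. $\mathbb{P}_1(\mathbb{X})$ is the set of Borel probability measures $\rho$ on $\mathbb{X}$ such that $E_\rho[d_{\mathbb{X}}(X,x_0)]<\infty$ for some (equivalently every) $x_0\in\mathbb{X}$. For $\rho,\tilde\rho\in\mathbb{P}_1(\mathbb{X})$ the $L^1$ Wasserstein distance is $W_1(\rho,\tilde\rho)=\inf_{\gamma\in\Pi(\rho,\tilde\rho)}\int_{\mathbb{X}\times\mathbb{X}}d_{\mathbb{X}}(x,\tilde x)\,\gamma(dx,d\tilde x)$, where $\Pi(\rho,\tilde\rho)$ is the set of couplings of $\rho$ and $\tilde\rho$ (probability measures on $\mathbb{X}\times\mathbb{X}$ with marginals $\rho,\tilde\rho$). The relative entropy is $D(\mu\|\nu)=E_\mu\left[\log\frac{d\mu}{d\nu}\right]$ if $\mu\ll\nu$, and $D(\mu\|\nu)=\infty$ otherwise (natural logarithm). $E_\nu[f]=E_\nu[f(X)]\in\mathbb{R}^k$ is the coordinatewise expectation of $f(X)$ with $X\sim\nu$ (it need not lie in $\mathbb{Y}$); $\|\cdot\|_p$ is the $\ell_p$-norm and $\|\cdot\|_\infty$ the maximum norm on $\mathbb{R}^k$. If $f(\mathbb{X})=\{E_\nu[f(X)]\}$, so that the supremum defining $\tau_p$ is over the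 empty set, $\tau_p$ may be taken to be any positive number. *)

(* Defs.v *)
From HB Require Import structures.
From mathcomp Require Import all_boot all_order all_algebra.
From mathcomp Require Import all_classical all_reals all_analysis.

Set Implicit Arguments.
Unset Strict Implicit.
Unset Printing Implicit Defensive.

Import Order.TTheory GRing.Theory Num.Theory.
Import numFieldNormedType.Exports.

Local Open Scope classical_set_scope.
Local Open Scope ring_scope.

(* Inhabited complete metric spaces. The base point, which the library requires
   of a complete space, is no restriction on a space that carries a
   probability measure. *)
#[short(type="completeMetricType")]
HB.structure Definition CompleteMetric (R : numDomainType) :=
  {T of Complete T & Metric R T}.

Definition separable (T : topologicalType) : Prop :=
  exists2 D : set T, countable D & dense D.

Notation borel T := (g_sigma_algebraType (@open T)).

(* The l_p norm for p in [1, +oo]; other values of p are never used. *)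
Definition lpnorm (R : realType) (k : nat) (p : \bar R) (v : 'rV[R]_k) : R :=
  match p with
  | r%:E => (\sum_(i < k) `|v 0 i| `^ r) `^ r^-1
  | +oo%E => \big[Num.max/0]_(i < k) `|v 0 i|
  | -oo%E => 0
  end.

Definition l2norm (R : realType) (k : nat) (v : 'rV[R]_k) : R :=
  lpnorm 2%:E v.

(* Y, with the Euclidean metric, is a complete separable metric space.
   The library's own metric on row vectors comes from the maximum norm. *)
Definition euclidean_polish (R : realType) (k : nat) (Y : set 'rV[R]_k) : Prop :=
  (exists2 D : set 'rV[R]_k, countable D /\ D `<=` Y &
     forall y e, Y y -> 0 < e -> exists2 q, D q & l2norm (y - q) < e) /\
  (forall u : nat -> 'rV[R]_k,
     (forall n, Y (u n)) ->
     (forall e, 0 < e -> exists N : nat, forall m n : nat,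
        (N <= m)%N -> (N <= n)%N -> l2norm (u m - u n) < e) ->
     exists2 l, Y l & forall e, 0 < e -> exists N : nat, forall n : nat,
        (N <= n)%N -> l2norm (u n - l) < e).

Section transport.
Context (R : realType) (T : completeMetricType R).
Implicit Types mu nu : probability (borel T) R.

Definition P1 mu : Prop :=
  exists x0 : T, (\int[mu]_x (@mdist R T x x0)%:E < +oo)%E.

(* Marginals are compared on Borel sets only: a measure is a function on all
   sets, with unspecified values outside the sigma-algebra. For separable T the
   product sigma-algebra below is the Borel one of T * T. *)
Definition coupling mu nu : set (probability (borel T * borel T)%type R) :=
  [set gamma | forall A : set (borel T), measurable A ->
     pushforward gamma fst A = mu A /\ pushforward gamma snd A = nu A].

Definition W1 mu nu : \bar R :=
  ereal_inf [set (\int[gamma]_z (@mdist R T z.1 z.2)%:E)%E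
            | gamma in coupling mu nu].

Definition relative_entropy mu nu : \bar R :=
  if `[< mu `<< nu >] then
    (\int[mu]_x lne (Radon_Nikodym (charge_of_finite_measure mu) nu x))%E
  else +oo%E.

End transport.

Section mean.
Context (R : realType) (T : completeMetricType R) (k : nat).
Variables (nu : probability (borel T) R) (f : T -> 'rV[R]_k).

Definition mean_coord (i : 'I_k) : \bar R :=
  'E_nu[fun x : borel T => f x 0 i].

Definition mean_norm_infty : \bar R :=
  \big[maxe/0%E]_(i < k) `|mean_coord i|%E.

(* Meaningful when [mean_norm_infty < +oo]. *)
Definition mean : 'rV[R]_k := \row_i fine (mean_coord i).

Definition norm_ratios (p : \bar R) : set R :=
  [set lpnorm p (y - mean) / l2norm (y - mean)
  | y in [set y | range f y /\ y <> mean]].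

(* The supremum over the empty set may be any positive number. The set of
   ratios is always bounded, norms on R^k being equivalent. *)
Definition is_tau (p : \bar R) (tau : R) : Prop :=
  (norm_ratios p !=set0 -> tau = sup (norm_ratios p)) /\
  (norm_ratios p = set0 -> 0 < tau).

End mean.

Definition lipschitz_const (R : realType) (T : completeMetricType R) (k : nat)
    (f : T -> 'rV[R]_k) (L : R) : Prop :=
  forall x x' : T, l2norm (f x - f x') <= L * mdist x x'.

(* Main.v *)
Require Import Defs.
From HB Require Import structures.
From mathcomp Require Import all_boot all_order all_algebra.
From mathcomp Require Import all_classical all_reals all_analysis.
From mathcomp Require Import measurable_realfun ring lra.

(** The transport inequality, applied to the exponential tilt exp(phi) nu / Z of
    nu, gives by Kantorovich-Rubinstein duality and AM-GM the Bobkov-Goetze bound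
      E exp(phi - E phi) <= exp(sigma^2 M^2 / 2)
    for every bounded M-Lipschitz phi; truncation and Fatou's lemma remove
    boundedness. For phi = <u, f> this says that v = f(X) - E f(X) is
    subgaussian, with parameter s = sigma L, in every direction u. Averaging over
    a Gaussian u, one coordinate at a time, yields
      E exp(a |v|_2^2 / (2 s^2)) <= (1 - a)^(-k/2)   for 0 <= a < 1,
    so that P(|v|_2 >= t) <= (1 - a)^(-k/2) exp(-a t^2 / (2 s^2)). With
    t = eps / tau, the choice a = 1/2 is the second bound. The choice
    a = (1 - veps)^2 gives the first one, without any covering of the sphere. *)

Set Implicit Arguments.
Unset Strict Implicit.
Unset Printing Implicit Defensive.

Import Order.TTheory GRing.Theory Num.Theory.
Import numFieldNormedType.Exports.

Local Open Scope classical_set_scope.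
Local Open Scope ring_scope.

(** * Lipschitz functions and monotonicity of the integral *)

(** Superlevel sets are open: if [phi x > a], the ball of radius [(phi x - a) / M] about [x] stays
    inside. *)
Lemma measurable_lipschitz (R : realType) (T : completeMetricType R) (M : R)
    (phi : T -> R) : 0 < M ->
  (forall x y, `|phi x - phi y| <= M * mdist x y) ->
  measurable_fun [set: borel T] (phi : borel T -> R).
Proof.
move=> M0 phi_lip.
apply: (measurability _ (@measurable_realfun.RGenOInfty.measurableE R)).
move=> _ [_ [a ->] <-]; rewrite setTI; apply: sub_sigma_algebra => /=.
rewrite openE => x /=; rewrite in_itv/= andbT => ax.
apply/nbhs_ballP; exists ((phi x - a) / M) => /=; first by rewrite divr_gt0 ?subr_gt0.
move=> y; rewrite ballEmdist/= ltr_pdivlMr// mulrC => xy.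
rewrite in_itv/= andbT -(ltrN2) -(ltrD2l (phi x)).
exact: le_lt_trans (le_trans (ler_norm _) (phi_lip x y)) xy.
Qed.

Lemma measurable_mdist (R : realType) (T : completeMetricType R) (x0 : T) :
  measurable_fun [set: borel T] (fun x : borel T => @mdist R T x x0).
Proof.
apply: (@measurable_lipschitz _ _ 1) => // x y; rewrite mul1r ler_norml.
rewrite lerNl opprB !lerBlDl; apply/andP; split; last first.
  by rewrite addrC; exact: metric_triangle.
by rewrite (metric_sym x y) addrC metric_triangle.
Qed.

(** The integral of a nonnegative function is a supremum over the simple functions below it, so a
    larger function has a larger supremum. In the duality bound this is applied to the distance on a
    product space. *)
Lemma ge0_le_integral_nonmeasurable d (T : measurableType d) (R : realType)
    (mu : {measure set T -> \bar R}) (f g : T -> \bar R) :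
  (forall x, 0 <= f x)%E -> (forall x, f x <= g x)%E ->
  (\int[mu]_x f x <= \int[mu]_x g x)%E.
Proof.
move=> f0 fg; have g0 x : (0 <= g x)%E by exact: le_trans (f0 x) (fg x).
rewrite !ge0_integralTE//; apply: le_ereal_sup => _ [h /= hf <-].
by exists h => //= x; exact: le_trans (hf x) (fg x).
Qed.

(** * Probability measures given by a density *)

Section density.
Context d (T : measurableType d) (R : realType) (nu : probability T R).
Variable g : T -> R.
Hypotheses (mg : measurable_fun [set: T] g) (g0 : forall x, 0 <= g x)
  (g1 : (\int[nu]_x (g x)%:E = 1)%E).

Definition density_measure (A : set T) : \bar R := (\int[nu]_(x in A) (g x)%:E)%E.

Let density0 : density_measure set0 = 0%E.
Proof. exact: integral_set0. Qed.

Let density_ge0 A : (0 <= density_measure A)%E.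
Proof. by apply: integral_ge0 => x _; rewrite lee_fin. Qed.

Let density_sigma_additive : semi_sigma_additive density_measure.
Proof.
apply: semi_sigma_additive_nng_induced; first exact/measurable_EFinP.
by move=> x; rewrite lee_fin.
Qed.

HB.instance Definition _ := isMeasure.Build _ _ _ density_measure
  density0 density_ge0 density_sigma_additive.

HB.instance Definition _ :=
  @Measure_isProbability.Build _ _ R density_measure g1.

Definition density_probability : probability T R := density_measure.

Lemma density_dominates : density_probability `<< nu.
Proof.
move=> A nA B BA mB; have nB := nA B BA mB.
by rewrite /= /density_measure; apply: null_set_integral => //;
  apply: measurable_funTS; exact/measurable_EFinP.
Qed.

(** Both functions have the same integral over every measurable set. *)
Lemma Radon_Nikodym_density :
  ae_eq nu setT (Radon_Nikodym (charge_of_finite_measure density_probability) nu)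
    (EFin \o g).
Proof.
apply: integral_ae_eq => //.
- by apply: Radon_Nikodym_integrable; exact: density_dominates.
- exact/measurable_EFinP.
- by move=> E _ mE; rewrite -Radon_Nikodym_integral//; exact: density_dominates.
Qed.

Lemma ge0_integral_density (h : T -> \bar R) :
  measurable_fun [set: T] h -> (forall x, 0 <= h x)%E ->
  (\int[density_probability]_x h x = \int[nu]_x (h x * (g x)%:E))%E.
Proof.
move=> mh h0.
rewrite -(Radon_Nikodym_SigmaFinite.change_of_variables density_dominates)//.
apply: ae_eq_integral => //.
- apply: emeasurable_funM => //.
  exact: measurable_int (Radon_Nikodym_SigmaFinite.f_integrable density_dominates).
- by apply: emeasurable_funM => //; exact/measurable_EFinP.
- apply: ae_eqe_mul2l.
  (* Two derivatives are in play: the sigma-finite one of the change of variables agrees almost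
     everywhere with [Radon_Nikodym], and the latter with [g]. *)
  apply: ae_eq_trans; last exact: Radon_Nikodym_density.
  exact: (@ae_eq_Radon_Nikodym_SigmaFinite _ _ _ density_probability nu
            density_dominates setT measurableT).
Qed.

End density.

(** * Bounded integrands and the dual lower bound on [W1] *)

Lemma bounded_integrable d (T : measurableType d) (R : realType)
    (mu : probability T R) (f : T -> R) (B : R) :
  measurable_fun [set: T] f -> (forall x, `|f x| <= B) ->
  mu.-integrable [set: T] (EFin \o f).
Proof.
move=> mf fB; apply: (@le_integrable _ _ _ mu _ measurableT _ (EFin \o cst B)).
- exact/measurable_EFinP.
- by move=> x _ /=; rewrite lee_fin (le_trans (fB x))// ler_norm.
- exact: finite_measure_integrable_cst.
Qed.

Lemma probability_Rintegral_cst d (T : measurableType d) (R : realType)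
    (mu : probability T R) (r : R) : \int[mu]_(x in [set: T]) r = r.
Proof.
rewrite Rintegral_cst//; have -> : fine (mu [set: T]) = 1 by rewrite probability_setT.
exact: mulr1.
Qed.

(* The easy half of Kantorovich-Rubinstein duality. *)
Lemma W1_ge_lipschitz (R : realType) (T : completeMetricType R)
    (mu nu : probability (borel T) R) (phi : T -> R) (M B : R) : 0 < M ->
  (forall x, `|phi x| <= B) ->
  (forall x y, `|phi x - phi y| <= M * mdist x y) ->
  (((\int[mu]_x phi x - \int[nu]_x phi x) / M)%:E <= W1 mu nu)%E.
Proof.
move=> M0 phiB phi_lip; apply: le_ereal_inf_tmp => _ [gamma cpl <-].
have mphi : measurable_fun [set: borel T] (phi : borel T -> R).
  exact: measurable_lipschitz phi_lip.
pose phi1 := fun z : borel T * borel T => phi z.1.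
pose phi2 := fun z : borel T * borel T => phi z.2.
have mphi1 : measurable_fun setT phi1 by exact: measurableT_comp.
have mphi2 : measurable_fun setT phi2 by exact: measurableT_comp.
have i1 : gamma.-integrable setT (EFin \o phi1).
  by apply: bounded_integrable => // z; exact: phiB.
have i2 : gamma.-integrable setT (EFin \o phi2).
  by apply: bounded_integrable => // z; exact: phiB.
(* Agreement of the marginals on measurable sets is enough to identify the integrals. *)
have e1 : \int[mu]_x phi x = \int[gamma]_z phi1 z.
  rewrite /Rintegral; congr fine.
  rewrite (eq_measure_integral (pushforward gamma fst)); last first.
    by move=> A mA _; exact: esym (cpl A mA).1.
  rewrite integral_pushforward//; exact/measurable_EFinP.
have e2 : \int[nu]_x phi x = \int[gamma]_z phi2 z.
  rewrite /Rintegral; congr fine.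
  rewrite (eq_measure_integral (pushforward gamma snd)); last first.
    by move=> A mA _; exact: esym (cpl A mA).2.
  rewrite integral_pushforward//; exact/measurable_EFinP.
have i12 : gamma.-integrable setT (EFin \o (fun z => phi1 z - phi2 z)).
  by apply: eq_integrable (integrableB measurableT i1 i2).
rewrite e1 e2 -RintegralB// -RintegralZr//.
have i12M : gamma.-integrable setT (EFin \o (fun z => (phi1 z - phi2 z) / M)).
  by apply: eq_integrable (integrableZr measurableT M^-1 i12).
rewrite /Rintegral fineK ?(integrable_fin_num _ i12M)//.
(* The absolute value makes the integrand nonnegative, so that the comparison with the distance
   needs only pointwise monotonicity. *)
apply: (@le_trans _ _ (\int[gamma]_z `|(phi1 z - phi2 z) / M|%:E)%E).
  apply: le_integral => //.
    exact: (integrable_norm i12M).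
  by move=> z _; rewrite lee_fin ler_norm.
apply: ge0_le_integral_nonmeasurable => z; rewrite lee_fin//.
by rewrite normf_div (gtr0_norm M0) ler_pdivrMr// mulrC phi_lip.
Qed.

(** * Extended-real logarithm and limit inferior *)

(** By monotonicity the preimage of a half-line is a half-line, [+oo] included; nonpositive
    arguments are sent to [-oo] and fall outside. This serves the integrand of the relative
    entropy. *)
Lemma measurable_lne (R : realType) : measurable_fun [set: \bar R] (@lne R).
Proof.
apply: (measurability _ (@measurable_realfun.ErealGenOInfty.measurableE R)).
move=> _ [_ [a ->] <-]; rewrite setTI.
rewrite (_ : _ @^-1` _ = `](expR a)%:E, +oo[%classic); first exact: emeasurable_itv.
apply/seteqP; split => -[r| |]//=; rewrite !in_itv/= ?andbT.
- case: (leP r 0) => //= r0; rewrite !lte_fin => ar.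
  by rewrite -[r]lnK ?posrE// ltr_expR.
- by rewrite !ltry.
- rewrite !lte_fin => ar; have r0 : 0 < r by exact: lt_trans (expR_gt0 a) ar.
  by rewrite leNgt r0/= lte_fin -ltr_expR lnK ?posrE.
- by rewrite !ltry.
Qed.

Lemma le_limn_einf (R : realType) (u v : (\bar R)^nat) :
  (forall n, u n <= v n)%E -> (limn_einf u <= limn_einf v)%E.
Proof.
move=> uv; rewrite !limn_einf_lim; apply: lee_lim; [exact: is_cvg_einfs..|].
apply: nearW => n; apply: le_ereal_inf_tmp => _ [k nk <-].
by apply: le_trans (uv k); apply: ereal_inf_lbound; exists k.
Qed.

(** * From the transport inequality to exponential moments *)

Section bobkov_goetze.
Context (R : realType) (T : completeMetricType R) (nu : probability (borel T) R).
Variables (sigma M : R).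
Hypotheses (nu_P1 : P1 nu) (sigma0 : 0 < sigma) (M0 : 0 < M).
Hypothesis transport : forall mu : probability (borel T) R, P1 mu ->
  (W1 mu nu <= sqrte ((2 * sigma ^+ 2)%:E * relative_entropy mu nu))%E.

(* The transport inequality is applied to the measure of density [exp psi];
   its relative entropy is the integral of [psi] against it. *)
Lemma normalized_exponential_bound (psi : T -> R) (B : R) :
  (forall x, `|psi x| <= B) ->
  (forall x y, `|psi x - psi y| <= M * mdist x y) ->
  (\int[nu]_x (expR (psi x))%:E = 1)%E ->
  - (\int[nu]_x psi x) <= sigma ^+ 2 * M ^+ 2 / 2.
Proof.
move=> psiB psi_lip psi1.
have mpsi : measurable_fun [set: borel T] (psi : borel T -> R).
  exact: measurable_lipschitz psi_lip.
have mg : measurable_fun [set: borel T] (fun x : borel T => expR (psi x)).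
  exact: measurableT_comp.
have g0 (x : borel T) : 0 <= expR (psi x) by exact: expR_ge0.
pose mu := density_probability mg g0 psi1.
have dom : mu `<< nu by exact: density_dominates.
have gB x : expR (psi x) <= expR B.
  by rewrite ler_expR (le_trans _ (psiB x))// ler_norm.
(* The density is at most [expR B], so the first moment stays finite. *)
have mu_P1 : P1 mu.
  have [x0 x0y] := nu_P1; exists x0.
  rewrite (ge0_integral_density mg g0 psi1)//; last 2 first.
  - by apply/measurable_EFinP; exact: measurable_mdist.
  - by move=> x; rewrite lee_fin mdist_ge0.
  apply: (@le_lt_trans _ _ (\int[nu]_x ((expR B)%:E * (@mdist R T x x0)%:E))%E).
    apply: ge0_le_integral_nonmeasurable => x; rewrite -EFinM lee_fin.
      by rewrite mulr_ge0// mdist_ge0.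
    by rewrite mulrC ler_wpM2r// mdist_ge0.
  rewrite ge0_integralZl//; last 2 first.
  - by apply/measurable_EFinP; exact: measurable_mdist.
  - by move=> x _; rewrite lee_fin mdist_ge0.
  by rewrite lte_mul_pinfty// ?lee_fin.
have ipsi (m : probability (borel T) R) : m.-integrable setT (EFin \o psi).
  exact: bounded_integrable mpsi psiB.
set D := \int[mu]_x psi x.
have entE : relative_entropy mu nu = D%:E.
  rewrite /relative_entropy asboolT//.
  rewrite /D /Rintegral fineK ?(integrable_fin_num _ (ipsi mu))//.
  (* The derivative is known [nu]-almost everywhere; domination turns this into [mu]-almost
     everywhere, where the entropy is integrated. *)
  have aeRN := null_dominates_ae_eq measurableT dom
    (Radon_Nikodym_density mg g0 psi1).
  apply: ae_eq_integral => //.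
  - apply: measurableT_comp; first exact: measurable_lne.
    apply: (measurable_int nu); apply: Radon_Nikodym_integrable; exact: dom.
  - exact/measurable_EFinP.
  - apply: filterS aeRN => x /= /(_ I) ->.
    by rewrite lne_EFin ?expR_gt0// expRK.
(* Nonnegativity of the entropy, needed to square the root below: integrate
   [1 - psi <= expR (- psi)] against [mu], the right side having [mu]-integral 1 because it cancels
   the density. *)
have D0 : 0 <= D.
  have iN : mu.-integrable setT (EFin \o (fun x : borel T => expR (- psi x))).
    apply: (@bounded_integrable _ _ _ _ _ (expR B)).
      by apply: measurableT_comp => //; exact: measurable_funN.
    move=> x; rewrite ger0_norm ?expR_ge0// ler_expR.
    by rewrite (le_trans _ (psiB x))// -normrN ler_norm.
  have N1 : \int[mu]_x expR (- psi x) = 1.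
    rewrite /Rintegral (ge0_integral_density mg g0 psi1)//;
      last exact: (measurable_int mu iN).
    under eq_integral do rewrite -EFinM -expRD addNr expR0.
    by rewrite integral_cst//= probability_setT mule1.
  have i1 : mu.-integrable setT (EFin \o (fun x => 1 - psi x)).
    apply: (@bounded_integrable _ _ _ _ _ (1 + B)).
      exact: measurable_funB.
    by move=> x; rewrite (le_trans (ler_normB _ _))// normr1 lerD2l.
  have : \int[mu]_x (1 - psi x) <= \int[mu]_x expR (- psi x).
    by apply: le_Rintegral => // x _; exact: expR_ge1Dx.
  rewrite N1 (RintegralB measurableT
    (finite_measure_integrable_cst mu 1 measurableT) (ipsi mu)).
  by rewrite probability_Rintegral_cst gerBl.
have := le_trans (W1_ge_lipschitz mu nu M0 psiB psi_lip) (transport mu_P1).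
rewrite entE -EFinM /= lee_fin ler_pdivrMr// -/D => W.
set S := Num.sqrt _ in W.
have S2 : S ^+ 2 = 2 * sigma ^+ 2 * D.
  by rewrite sqr_sqrtr// mulr_ge0// mulr_ge0// sqr_ge0.
(* AM-GM: expanding gives [S * M - D <= sigma ^+ 2 * M ^+ 2 / 2], while [W] bounds the difference of
   the means by [S * M]. *)
have : 0 <= (S / sigma - sigma * M) ^+ 2 by exact: sqr_ge0.
rewrite sqrrB.
have -> : (S / sigma) ^+ 2 = 2 * D.
  by rewrite exprMn S2 exprVn; field; rewrite gt_eqF.
have -> : S / sigma * (sigma * M) = S * M by field; rewrite gt_eqF.
rewrite exprMn; lra.
Qed.

(** Subtracting [ln Z], with [Z] the mean of [expR phi], normalizes the exponential and keeps the
    Lipschitz constant; the normalized bound then reads as an upper bound on [ln Z]. *)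
Lemma bounded_lipschitz_mgf (phi : T -> R) (B : R) :
  (forall x, `|phi x| <= B) ->
  (forall x y, `|phi x - phi y| <= M * mdist x y) ->
  (\int[nu]_x (expR (phi x))%:E <=
   (expR ((\int[nu]_x phi x) + sigma ^+ 2 * M ^+ 2 / 2))%:E)%E.
Proof.
move=> phiB phi_lip.
have mphi : measurable_fun [set: borel T] (phi : borel T -> R).
  exact: measurable_lipschitz phi_lip.
have iphi : nu.-integrable setT (EFin \o phi) by exact: bounded_integrable mphi phiB.
have mexp : measurable_fun [set: borel T] (fun x : borel T => expR (phi x)).
  exact: measurableT_comp.
have iexp : nu.-integrable setT (EFin \o (fun x : borel T => expR (phi x))).
  apply: (@bounded_integrable _ _ _ _ _ (expR B)) => // x.
  by rewrite ger0_norm ?expR_ge0// ler_expR (le_trans _ (phiB x))// ler_norm.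
set Z := \int[nu]_x expR (phi x).
have intE : (\int[nu]_x (expR (phi x))%:E = Z%:E)%E.
  by rewrite /Z /Rintegral fineK// (integrable_fin_num _ iexp).
have Z0 : 0 < Z.
  apply: (@lt_le_trans _ _ (\int[nu]_x expR (- B))).
    by rewrite probability_Rintegral_cst expR_gt0.
  apply: (le_Rintegral measurableT (finite_measure_integrable_cst nu _ measurableT) iexp).
  move=> x _; rewrite /= ler_expR lerNl (le_trans _ (phiB x))//.
  by rewrite -normrN ler_norm.
have psi_lip x y : `|(phi x - ln Z) - (phi y - ln Z)| <= M * mdist x y.
  by rewrite opprB addrA subrK.
have psiB x : `|phi x - ln Z| <= B + `|ln Z|.
  by rewrite (le_trans (ler_normB _ _))// lerD2r.
have psi1 : (\int[nu]_x (expR (phi x - ln Z))%:E = 1)%E.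
  under eq_integral do rewrite expRD expRN lnK ?posrE// EFinM.
  rewrite integralZr// intE -EFinM divff// gt_eqF//.
have := normalized_exponential_bound psiB psi_lip psi1.
rewrite (RintegralB measurableT iphi (finite_measure_integrable_cst nu _ measurableT)).
rewrite probability_Rintegral_cst opprB lerBlDl => le.
by rewrite intE lee_fin -[leLHS]lnK ?posrE// ler_expR.
Qed.

(** The function is dominated by [|phi x0| + M * mdist x x0], integrable since [nu] has a finite
    first moment. *)
Lemma lipschitz_integrable (phi : T -> R) :
  (forall x y, `|phi x - phi y| <= M * mdist x y) ->
  nu.-integrable [set: borel T] (EFin \o phi).
Proof.
move=> phi_lip; have [x0 x0y] := nu_P1.
have mphi : measurable_fun [set: borel T] (phi : borel T -> R).
  exact: measurable_lipschitz phi_lip.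
have id : nu.-integrable [set: borel T] (EFin \o (fun x => @mdist R T x x0)).
  apply/integrableP; split; first by apply/measurable_EFinP; exact: measurable_mdist.
  by under eq_integral do rewrite /= ger0_norm ?mdist_ge0//.
have idc : nu.-integrable [set: borel T]
    (EFin \o (fun x => `|phi x0| + M * @mdist R T x x0)).
  apply: (eq_integrable measurableT _ _ _ (integrableD measurableT
    (finite_measure_integrable_cst nu `|phi x0| measurableT)
    (integrableZl measurableT M id))) => x _ /=.
  by rewrite EFinD EFinM.
apply: le_integrable idc => //; first exact/measurable_EFinP.
move=> x _ /=; rewrite lee_fin (le_trans _ (ler_norm _))//.
by rewrite -[phi x](subrK (phi x0)) (le_trans (ler_normD _ _))// addrC lerD2l.
Qed.

(** Truncations at height [n] are bounded and still [M]-Lipschitz. Their means converge by dominated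
    convergence, and Fatou's lemma handles the exponentials. *)
Lemma lipschitz_mgf (phi : T -> R) :
  (forall x y, `|phi x - phi y| <= M * mdist x y) ->
  (\int[nu]_x (expR (phi x))%:E <=
   (expR ((\int[nu]_x phi x) + sigma ^+ 2 * M ^+ 2 / 2))%:E)%E.
Proof.
move=> phi_lip.
have mphi : measurable_fun [set: borel T] (phi : borel T -> R).
  exact: measurable_lipschitz phi_lip.
have iphi := lipschitz_integrable phi_lip.
pose trunc n x : R := Num.max (- n%:R) (Num.min (phi x) n%:R).
(* This case split reduces each property of the truncation to linear arithmetic. *)
have truncP n x : [\/ phi x < - n%:R /\ trunc n x = - n%:R,
    - n%:R <= phi x <= n%:R /\ trunc n x = phi x |
    n%:R < phi x /\ trunc n x = n%:R].
  have n0 := ler0n R n; rewrite /trunc.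
  have [xn|nx] := leP (phi x) n%:R; last first.
    by apply: Or33; split => //; apply: max_r; lra.
  have [nx|xn'] := leP (- n%:R) (phi x); last by apply: Or31.
  by apply: Or32; split => //; apply/andP.
have truncB n x : `|trunc n x| <= n%:R.
  have n0 := ler0n R n; rewrite ler_norml.
  by case: (truncP n x) => -[h ->]; lra.
have trunc_phi n x : `|trunc n x| <= `|phi x|.
  have n0 := ler0n R n; have := ler_norm (phi x); have := ler_norm (- phi x).
  rewrite normrN => N1 N2; rewrite ler_norml.
  by case: (truncP n x) => -[h ->]; lra.
have trunc_lip n x y : `|trunc n x - trunc n y| <= M * mdist x y.
  have n0 := ler0n R n.
  have := phi_lip x y; rewrite !ler_norml => h.
  have md : 0 <= M * mdist x y by rewrite mulr_ge0 ?mdist_ge0// ltW.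
  by case: (truncP n x) (truncP n y) => -[h1 ->] [] [h2 ->]; lra.
have mtrunc n : measurable_fun [set: borel T] (trunc n : borel T -> R).
  exact: measurable_lipschitz (trunc_lip n).
(* The sequence is constant once [n] exceeds [|phi x|]. *)
have trunc_cvg x : trunc n x @[n --> \oo] --> phi x.
  apply: cvg_near_cst; exists (Num.bound (phi x)) => //= n /= xn.
  have : `|phi x| <= n%:R.
    by rewrite (le_trans (ltW (unstable.ltr_norm_bound _)))// ler_nat.
  by rewrite ler_norml => /andP[xn1 xn2]; rewrite /trunc min_l// max_r.
have cvgE (u : R^nat) (l : R) : u n @[n --> \oo] --> l ->
    (u n)%:E @[n --> \oo] --> l%:E.
  by move=> ul; apply: cvg_EFin => //; exact: nearW.
have [_ _ int_cvg] := dominated_convergence measurableT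
  (fun n => (measurable_EFinP _ _).2 (mtrunc n)) ((measurable_EFinP _ _).2 mphi)
  (aeW nu (fun x _ => cvgE _ _ (trunc_cvg x)))
  (integrable_norm iphi)
  (aeW nu (fun x n _ => trunc_phi n x)).
have iB n : nu.-integrable [set: borel T] (EFin \o trunc n).
  exact: bounded_integrable (mtrunc n) (truncB n).
have rint_cvg : \int[nu]_x trunc n x @[n --> \oo] --> \int[nu]_x phi x.
  apply: fine_cvg; rewrite fineK ?(integrable_fin_num _ iphi)//.
(* The left side of Fatou is the integral of a true limit; the right side is bounded by the bounds
   for the truncations, which converge to the claimed one. *)
have := @fatou _ _ _ nu _ measurableT (fun n x => (expR (trunc n x))%:E)
  (fun n => (measurable_EFinP _ _).2 (measurableT_comp (@measurable_expR R) (mtrunc n)))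
  (fun n x _ => expR_ge0 (trunc n x)).
under eq_integral.
  move=> x _.
  rewrite (cvg_limn_einf_sup (cvgE _ _
    (continuous_cvg _ (@continuous_expR R _) (trunc_cvg x)))).1.
  over.
move=> /le_trans; apply.
apply: le_trans.
  apply: le_limn_einf => n.
  exact: (bounded_lipschitz_mgf (truncB n) (trunc_lip n)).
rewrite (cvg_limn_einf_sup (l := (expR ((\int[nu]_x phi x) +
  sigma ^+ 2 * M ^+ 2 / 2))%:E) _).1//.
apply: cvgE.
apply: continuous_cvg; first exact: continuous_expR.
by apply: cvgD => //; exact: cvg_cst.
Qed.
End bobkov_goetze.

(** * Squares in the exponent by averaging over Gaussian directions *)

Section gaussian_linearization.
Context (R : realType).
Local Notation leb := (@lebesgue_measure R).

(** Completing the square: the integrand is [expR (t ^+ 2 / 2)] times the normal density of mean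
    [t]. *)
Lemma integral_expR_normal_pdf (t : R) :
  (\int[leb]_g (expR (t * g) * normal_pdf 0 1 g)%:E = (expR (t ^+ 2 / 2))%:E)%E.
Proof.
have e g : expR (t * g) * normal_pdf 0 1 g = expR (t ^+ 2 / 2) * normal_pdf t 1 g.
  rewrite !normal_pdfE ?oner_neq0// mulrCA [RHS]mulrCA; congr (_ * _).
  by rewrite /normal_fun -!expRD; congr expR; field.
under eq_integral do rewrite e EFinM.
rewrite integralZl//; last exact: integrable_normal_pdf.
by rewrite integral_normal_pdf mule1.
Qed.

(** The integrand is [c] times the centered normal density of standard deviation [c], whose inverse
    variance is [1 - a]. *)
Lemma integral_expR_sqr_normal_pdf (a : R) : a < 1 ->
  (\int[leb]_g (expR (a * g ^+ 2 / 2) * normal_pdf 0 1 g)%:E =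
   ((Num.sqrt (1 - a))^-1)%:E)%E.
Proof.
move=> a1; set c := (Num.sqrt (1 - a))^-1.
have c0 : 0 < c by rewrite invr_gt0 sqrtr_gt0 subr_gt0.
have c2 : c ^+ 2 = (1 - a)^-1 by rewrite exprVn sqr_sqrtr// subr_ge0 ltW.
have e g : expR (a * g ^+ 2 / 2) * normal_pdf 0 1 g = c * normal_pdf 0 c g.
  rewrite !normal_pdfE ?oner_neq0 ?gt_eqF// mulrCA [RHS]mulrA; congr (_ * _).
    rewrite /normal_peak expr1n mul1r -mulrnAr sqrtrM ?sqr_ge0//.
    by rewrite sqrtr_sqr gtr0_norm// invfM mulrA divff ?mul1r// gt_eqF.
  rewrite /normal_fun -!expRD c2; congr expR.
  by rewrite -mulr_natr; field; lra.
under eq_integral do rewrite e EFinM.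
rewrite integralZl//; last exact: integrable_normal_pdf.
by rewrite integral_normal_pdf mule1.
Qed.

Context d (T : measurableType d) (nu : probability T R).
Variables (k : nat) (v : 'I_k -> T -> R) (s a : R).
Hypotheses (mv : forall i, measurable_fun [set: T] (v i))
  (s0 : 0 < s) (a0 : 0 <= a) (a1 : a < 1).
Hypothesis subgaussian : forall u : 'I_k -> R,
  (\int[nu]_x (expR (\sum_i u i * v i x))%:E <=
   (expR (s ^+ 2 * (\sum_i u i ^+ 2) / 2))%:E)%E.

(** Scale of the Gaussian direction, chosen so that [s ^+ 2 * b ^+ 2 = a]. *)
Let b : R := Num.sqrt a / s.

Let b2 : b ^+ 2 = a / s ^+ 2.
Proof. by rewrite /b expr_div_n sqr_sqrtr. Qed.

(** Interpolates between the linear form in [u], at [j = 0], and half the squared norm of [b v], at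
    [j = k]. *)
Let expo (j : nat) (u : 'I_k -> R) (x : T) : R :=
  \sum_(i < k) (if (i < j)%N then b ^+ 2 * v i x ^+ 2 / 2 else u i * v i x).

(* The first [j] coordinates are already squared; one more is treated by
   writing [expR (t ^+ 2 / 2)] as the Gaussian mean of [expR (t * g)]. *)
Let partially_squared (j : nat) (u : 'I_k -> R) : (j <= k)%N ->
  (\int[nu]_x (expR (expo j u x))%:E <=
   ((Num.sqrt (1 - a))^-1 ^+ j *
    expR (s ^+ 2 * (\sum_(i < k | (j <= i)%N) u i ^+ 2) / 2))%:E)%E.
Proof.
elim: j u => [|j IH] u jk; first by rewrite expr0 mul1r; exact: subgaussian.
pose oj := Ordinal jk.
pose rest x := \sum_(i < k | i != oj)
  (if (i < j)%N then b ^+ 2 * v i x ^+ 2 / 2 else u i * v i x).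
have mrest : measurable_fun [set: T] rest.
  rewrite /rest; under eq_fun do rewrite big_mkcond.
  apply: measurable_sum => i.
  have [_|_] := boolP (i != oj); last exact: measurable_cst.
  have [_|_] := boolP (i < j)%N.
    apply: measurable_funM => //; apply: measurable_funM => //.
    exact: measurable_funX.
  exact: measurable_funM.
have expoS x : expo j.+1 u x = (b * v oj x) ^+ 2 / 2 + rest x.
  rewrite /expo (bigD1 oj)//= ltnSn (exprMn 2 b); congr (_ + _).
  by rewrite /rest; apply: eq_bigr => i ij;
    rewrite ltnS leq_eqVlt -[i == j :> nat]/(i == oj) (negbTE ij).
(* With [b * g] in slot [j], the exponent of stage [j] is linear in [g], and averaging over [g]
   produces stage [j.+1]. *)
pose u' g i := if i == oj then b * g else u i.
have expo' g x : expo j (u' g) x = b * v oj x * g + rest x.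
  rewrite /expo (bigD1 oj)//= ltnn /u' eqxx; congr (_ + _); first by ring.
  by rewrite /rest; apply: eq_bigr => i ij; rewrite (negbTE ij).
pose S := \sum_(i < k | (j.+1 <= i)%N) u i ^+ 2.
have S' g : \sum_(i < k | (j <= i)%N) u' g i ^+ 2 = (b * g) ^+ 2 + S.
  rewrite (bigD1 oj)//= /u' eqxx; congr (_ + _); apply: eq_big => i.
    by rewrite [RHS]ltn_neqAle andbC eq_sym.
  by move=> /andP[_ /negbTE ->].
pose F (z : T * R) : \bar R :=
  (expR (b * v oj z.1 * z.2 + rest z.1) * normal_pdf 0 1 z.2)%:E.
have mF : measurable_fun [set: T * R] F.
  apply/measurable_EFinP; apply: measurable_funM.
    apply: measurableT_comp => //; apply: measurable_funD.
      apply: measurable_funM => //; apply: measurable_funM => //.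
      exact: measurableT_comp.
    exact: measurableT_comp.
  by apply: measurableT_comp => //; exact: measurable_normal_pdf.
have F0 z : (0 <= F z)%E by rewrite lee_fin mulr_ge0 ?expR_ge0// normal_pdf_ge0.
have stepL x : (expR (expo j.+1 u x))%:E = (\int[leb]_g F (x, g))%E.
  rewrite expoS expRD EFinM -integral_expR_normal_pdf muleC.
  rewrite -ge0_integralZl//; last 2 first.
  - apply/measurable_EFinP; apply: measurable_funM.
      by apply: measurableT_comp => //; exact: measurable_funM.
    exact: measurable_normal_pdf.
  - by move=> g _; rewrite lee_fin mulr_ge0 ?expR_ge0// normal_pdf_ge0.
  by apply: eq_integral => g _; rewrite /F/= -EFinM expRD; congr EFin; ring.
under eq_integral do rewrite stepL.
(* After the exchange, the inner integral for fixed [g] is stage [j] at [u' g], up to the Gaussian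
   weight, so the induction hypothesis bounds it. *)
rewrite (@fubini_tonelli _ _ _ _ R nu leb F mF F0).
set C := (Num.sqrt (1 - a))^-1 in IH *.
have C0 : 0 < C by rewrite invr_gt0 sqrtr_gt0 subr_gt0.
pose K := C ^+ j * expR (s ^+ 2 * S / 2).
have K0 : 0 <= K by rewrite mulr_ge0 ?expR_ge0// exprn_ge0// ltW.
have mG : measurable_fun [set: R] (fun g : R => expR (a * g ^+ 2 / 2) * normal_pdf 0 1 g).
  apply: measurable_funM; last exact: measurable_normal_pdf.
  apply: measurableT_comp => //; apply: measurable_funM => //.
  by apply: measurable_funM => //; exact: measurable_funX.
apply: (@le_trans _ _ (\int[leb]_g
    (K%:E * (expR (a * g ^+ 2 / 2) * normal_pdf 0 1 g)%:E))%E).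
  apply: ge0_le_integral_nonmeasurable => g; first by apply: integral_ge0.
  rewrite /F/=; under eq_integral do rewrite -expo' EFinM.
  rewrite ge0_integralZr//; last 2 first.
  - apply/measurable_EFinP; apply: measurableT_comp => //.
    rewrite (_ : expo j (u' g) = fun x => b * v oj x * g + rest x); last first.
      exact/funext.
    by apply: measurable_funD => //; do 2 apply: measurable_funM => //.
  - by rewrite lee_fin normal_pdf_ge0.
  rewrite (EFinM (expR _)) muleA.
  apply: lee_wpmul2r; first by rewrite lee_fin normal_pdf_ge0.
  apply: le_trans (IH (u' g) (ltnW jk)) _.
  rewrite S' /K -EFinM lee_fin -(mulrA (C ^+ j)) ler_pM2l ?exprn_gt0// -expRD ler_expR.
  rewrite exprMn b2 le_eqVlt; apply/orP; left; apply/eqP.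
  by field; rewrite gt_eqF.
rewrite ge0_integralZl//; last 2 first.
- exact/measurable_EFinP.
- by move=> g _; rewrite lee_fin mulr_ge0 ?expR_ge0// normal_pdf_ge0.
(* The remaining integral over [g] supplies the extra factor [C]. *)
rewrite integral_expR_sqr_normal_pdf// -EFinM lee_fin /K (exprSr C).
by rewrite -/C -/S (mulrAC (C ^+ j)).
Qed.

(** This is the last stage [j = k], where every coordinate is squared and [u] no longer matters; it
    is taken to be 0. *)
Lemma subgaussian_square_mgf :
  (\int[nu]_x (expR (a / (2 * s ^+ 2) * \sum_i v i x ^+ 2))%:E <=
   ((Num.sqrt (1 - a))^-1 ^+ k)%:E)%E.
Proof.
have := partially_squared (fun=> 0) (leqnn k).
rewrite [X in expR (_ * X / _)]big1; last by move=> i _; rewrite expr0n.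
rewrite mulr0 mul0r expR0 mulr1; apply: le_trans.
rewrite le_eqVlt; apply/orP; left; apply/eqP; apply: eq_integral => x _.
congr ((expR _)%:E); rewrite /expo mulr_sumr; apply: eq_bigr => i _.
by rewrite ltn_ord b2; field; rewrite gt_eqF.
Qed.

End gaussian_linearization.

(** * Superlevel sets and norms of row vectors *)

Lemma measurable_superlevel d (T : measurableType d) (R : realType)
    (h : T -> R) (t : R) :
  measurable_fun [set: T] h -> measurable [set x | t <= h x].
Proof.
move=> mh; rewrite -[[set x | _]]setTI.
have := measurable_fun_ler (measurable_cst t) mh.
by move=> /(_ measurableT [set true] I).
Qed.

Section norms.
Context (R : realType) (k : nat).
Implicit Types (v w : 'rV[R]_k) (u : 'I_k -> R) (p : \bar R).

Lemma l2normE v : l2norm v = Num.sqrt (\sum_i v 0 i ^+ 2).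
Proof.
rewrite /l2norm /lpnorm powR12_sqrt; last by apply: sumr_ge0 => i _; exact: powR_ge0.
congr Num.sqrt; apply: eq_bigr => i _.
by rewrite (powR_mulrn 2)// real_normK// num_real.
Qed.

Lemma l2norm_ge0 v : 0 <= l2norm v. Proof. by rewrite l2normE sqrtr_ge0. Qed.

Lemma l2norm_sqr v : l2norm v ^+ 2 = \sum_i v 0 i ^+ 2.
Proof. by rewrite l2normE sqr_sqrtr// sumr_ge0// => i _; exact: sqr_ge0. Qed.

Lemma ler_coord_l2norm v i : `|v 0 i| <= l2norm v.
Proof.
rewrite l2normE -sqrtr_sqr ler_wsqrtr// (bigD1 i)//= lerDl.
by apply: sumr_ge0 => j _; exact: sqr_ge0.
Qed.

Lemma l2norm_eq0 v : l2norm v = 0 -> v = 0.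
Proof.
move=> v0; apply/rowP => i; rewrite mxE; apply/eqP.
by rewrite -normr_le0 -v0 ler_coord_l2norm.
Qed.

(** Cauchy-Schwarz: the sum of the squares of [A * v 0 i - C * u i] equals [A * (A * B - C ^+ 2)],
    and [A] can be divided out unless [u] vanishes. *)
Lemma ler_dot_l2norm u v :
  `|\sum_i u i * v 0 i| <= Num.sqrt (\sum_i u i ^+ 2) * l2norm v.
Proof.
set A := \sum_i u i ^+ 2; set C := \sum_i u i * v 0 i.
have A0 : 0 <= A by apply: sumr_ge0 => i _; exact: sqr_ge0.
rewrite l2normE -sqrtr_sqr -sqrtrM//; apply: ler_wsqrtr.
set B := \sum_i v 0 i ^+ 2.
have [A_eq0|A_neq0] := eqVneq A 0.
  suff -> : C = 0 by rewrite A_eq0 mul0r expr0n.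
  apply: big1 => i _; have /eqP := A_eq0.
  rewrite psumr_eq0; last by move=> j _; exact: sqr_ge0.
  by move=> /allP/(_ i); rewrite mem_index_enum sqrf_eq0 => /(_ isT)/eqP ->;
    rewrite mul0r.
have A_gt0 : 0 < A by rewrite lt_def A_neq0.
have : 0 <= \sum_i (A * v 0 i - C * u i) ^+ 2.
  by apply: sumr_ge0 => i _; exact: sqr_ge0.
have -> : \sum_i (A * v 0 i - C * u i) ^+ 2 = A * (A * B - C ^+ 2).
  transitivity (\sum_i (A ^+ 2 * v 0 i ^+ 2 + (- 2 * A * C) * (u i * v 0 i)
      + C ^+ 2 * u i ^+ 2)); first by apply: eq_bigr => i _; ring.
  by rewrite !big_split/= -!mulr_sumr -/A -/B -/C; ring.
by rewrite pmulr_rge0// subr_ge0.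
Qed.

Lemma lpnorm0 p : (1 <= p)%E -> lpnorm p (0 : 'rV[R]_k) = 0.
Proof.
case: p => [r| |]//=.
- rewrite lee_fin => r1; have r0 : r != 0 by rewrite gt_eqF// (lt_le_trans ltr01).
  rewrite big1 ?powR0 ?invr_eq0// => i _.
  by rewrite mxE normr0 powR0.
- move=> _; apply: (big_ind (fun x => x = 0)) => // [x y -> ->|i _].
    by rewrite maxxx.
  by rewrite mxE normr0.
Qed.

(** Each coordinate is at most the Euclidean norm, so [k] to the power [1 / r] works for finite [r],
    and 1 for the maximum norm. This bounds the ratios defining [tau]. *)
Lemma lpnorm_le_l2norm p : (1 <= p)%E ->
  exists C : R, forall v, lpnorm p v <= C * l2norm v.
Proof.
case: p => [r| |]//=.
- rewrite lee_fin => r1; have r0 : 0 < r by rewrite (lt_le_trans ltr01).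
  exists (k%:R `^ r^-1) => v.
  have le_sum : \sum_i `|v 0 i| `^ r <= k%:R * l2norm v `^ r.
    apply: (@le_trans _ _ (\sum_(i < k) l2norm v `^ r)).
      apply: ler_sum => i _; apply: ge0_ler_powR; rewrite ?nnegrE ?(ltW r0)//.
        exact: l2norm_ge0.
      exact: ler_coord_l2norm.
    by rewrite sumr_const card_ord mulr_natl.
  have -> : k%:R `^ r^-1 * l2norm v = (k%:R * l2norm v `^ r) `^ r^-1.
    by rewrite powRM ?powR_ge0// -powRrM mulfV ?gt_eqF// powRr1// l2norm_ge0.
  apply: ge0_ler_powR; rewrite ?nnegrE ?invr_ge0 ?(ltW r0)//.
    by apply: sumr_ge0 => i _; exact: powR_ge0.
  by rewrite mulr_ge0// powR_ge0.
- move=> _; exists 1 => v; rewrite mul1r; apply: bigmax_le; first exact: l2norm_ge0.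
  by move=> i _; exact: ler_coord_l2norm.
Qed.

Lemma measurable_lpnorm d (T : measurableType d) p (h : T -> 'rV[R]_k) :
  (1 <= p)%E -> (forall i, measurable_fun [set: T] (fun x => h x 0 i)) ->
  measurable_fun [set: T] (fun x => lpnorm p (h x)).
Proof.
move=> p1 mh; have mhn i : measurable_fun [set: T] (fun x => `|h x 0 i|).
  exact: measurableT_comp.
case: p p1 => [r| |]//= _.
- apply: (measurableT_comp (measurable_powR _)); apply: measurable_sum => i.
  exact: (measurableT_comp (measurable_powR _)).
- elim: (index_enum _) => [|i s IH].
    by under eq_fun do rewrite big_nil; exact: measurable_cst.
  by under eq_fun do rewrite big_cons; exact: measurable_maxr.
Qed.

End norms.

(** * Concentration of the Euclidean norm of the centered map *)

Section concentration.
Context (R : realType) (T : completeMetricType R) (nu : probability (borel T) R).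
Variables (sigma L : R) (k : nat) (f : T -> 'rV[R]_k).
Hypotheses (nu_P1 : P1 nu) (sigma0 : 0 < sigma) (L0 : 0 < L).
Hypothesis transport : forall mu : probability (borel T) R, P1 mu ->
  (W1 mu nu <= sqrte ((2 * sigma ^+ 2)%:E * relative_entropy mu nu))%E.
Hypothesis f_lip : lipschitz_const f L.

Let v (i : 'I_k) (x : T) : R := (f x - mean nu f) 0 i.

Let v_lip i (x y : T) : `|v i x - v i y| <= L * mdist x y.
Proof.
apply: le_trans (f_lip x y); rewrite (le_trans _ (ler_coord_l2norm _ i))//.
by rewrite /v !mxE opprB addrA subrK.
Qed.

Lemma measurable_centered_coord i :
  measurable_fun [set: borel T] (fun x : borel T => (f x - mean nu f) 0 i).
Proof. exact: (measurable_lipschitz L0 (v_lip i)). Qed.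

Let iv i : nu.-integrable [set: borel T] (EFin \o v i).
Proof. exact: (lipschitz_integrable nu_P1 L0 (v_lip i)). Qed.

Let v_mean i : (\int[nu]_x (v i x)%:E = 0)%E.
Proof.
have ifi : nu.-integrable [set: borel T] (EFin \o (fun x : borel T => f x 0 i)).
  apply: (lipschitz_integrable nu_P1 L0 (phi := fun x => f x 0 i)) => x y.
  by have := v_lip i x y; rewrite /v !mxE opprB addrA subrK.
rewrite /v; under eq_integral do rewrite !mxE EFinB.
rewrite integralB//; last exact: finite_measure_integrable_cst.
rewrite integral_cst// /mean_coord unlock.
(* Integrability makes the coordinate mean finite, so [fine] in [mean] returns the true value. *)
rewrite fineK; last exact: integrable_fin_num ifi.
by rewrite [X in (_ * X)%E]probability_setT mule1 subee// (integrable_fin_num _ ifi).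
Qed.

(** By Cauchy-Schwarz the linear form is Lipschitz with constant [L] times the Euclidean norm of
    [u], and its mean is 0. *)
Lemma dot_subgaussian (u : 'I_k -> R) :
  (\int[nu]_x (expR (\sum_i u i * v i x))%:E <=
   (expR ((sigma * L) ^+ 2 * (\sum_i u i ^+ 2) / 2))%:E)%E.
Proof.
set A := \sum_i u i ^+ 2.
have A0 : 0 <= A by apply: sumr_ge0 => i _; exact: sqr_ge0.
(* The exponential bound asks for a positive Lipschitz constant, so [u = 0] is separate. *)
have [A_eq0|A_neq0] := eqVneq A 0.
  have u0 i : u i = 0.
    have /eqP := A_eq0; rewrite psumr_eq0; last by move=> j _; exact: sqr_ge0.
    by move=> /allP/(_ i); rewrite mem_index_enum sqrf_eq0 => /(_ isT)/eqP.
  under eq_integral => x _.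
    rewrite big1; last by move=> i _; rewrite u0 mul0r.
    rewrite expR0; over.
  rewrite integral_cst//= mul1e A_eq0 mulr0 mul0r expR0.
  by rewrite probability_setT.
have M0 : 0 < L * Num.sqrt A by rewrite mulr_gt0// sqrtr_gt0 lt_def A_neq0.
have phi_lip (x y : T) : `|\sum_i u i * v i x - \sum_i u i * v i y| <=
    L * Num.sqrt A * mdist x y.
  have -> : \sum_i u i * v i x - \sum_i u i * v i y =
      \sum_i u i * (f x - f y) 0 i.
    by rewrite -sumrB; apply: eq_bigr => i _; rewrite /v !mxE; ring.
  rewrite (le_trans (ler_dot_l2norm _ _))// -/A mulrAC [leRHS]mulrC.
  by rewrite ler_wpM2l ?sqrtr_ge0//; exact: f_lip.
apply: le_trans (lipschitz_mgf nu_P1 sigma0 M0 transport phi_lip) _.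
rewrite [X in X + _](_ : _ = 0).
  rewrite add0r !exprMn sqr_sqrtr// lee_fin ler_expR.
  by rewrite le_eqVlt; apply/orP; left; apply/eqP; ring.
rewrite /Rintegral; under eq_integral do rewrite -sumEFin.
rewrite integral_sum//; last first.
  move=> i; under eq_fun do rewrite EFinM.
  exact: (integrableZl measurableT (u i) (iv i)).
rewrite big1// => i _.
under eq_integral do rewrite EFinM.
by rewrite integralZl ?v_mean ?mule0// iv.
Qed.

(** Markov's inequality for the exponential of [c] times the squared norm. *)
Lemma l2norm_tail (a t : R) : 0 <= a -> a < 1 -> 0 <= t ->
  (nu [set x | (t <= l2norm (f x - mean nu f))%R] <=
   ((Num.sqrt (1 - a))^-1 ^+ k *
    expR (- (a * t ^+ 2 / (2 * (sigma * L) ^+ 2))))%:E)%E.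
Proof.
move=> a0 a1 t0; set A : set (borel T) := [set x | _].
set s := sigma * L; have s0 : 0 < s by rewrite mulr_gt0.
have mA : measurable A.
  have mn : measurable_fun [set: borel T]
      (fun x : borel T => l2norm (f x - mean nu f)).
    apply: measurable_lpnorm; first by rewrite lee_fin ler1n.
    exact: measurable_centered_coord.
  exact: measurable_superlevel.
have := subgaussian_square_mgf measurable_centered_coord s0 a0 a1 dot_subgaussian.
set c := a / (2 * s ^+ 2) => H.
have c0 : 0 <= c by rewrite divr_ge0// mulr_ge0// sqr_ge0.
have : ((expR (c * t ^+ 2))%:E * nu A <=
    \int[nu]_x (expR (c * \sum_i v i x ^+ 2))%:E)%E.
  rewrite -[A in nu A]setIT -integral_indic// -ge0_integralZl//;
    last by apply/measurable_EFinP; exact: measurable_indic.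
  apply: ge0_le_integral_nonmeasurable => x; rewrite -EFinM lee_fin.
    by rewrite mulr_ge0 ?expR_ge0.
  rewrite indicE; have [|_] := boolP (x \in A); last by rewrite mulr0 expR_ge0.
  rewrite inE /A/= => tx; rewrite mulr1 ler_expR ler_wpM2l//.
  by rewrite -l2norm_sqr ler_sqr ?nnegrE// l2norm_ge0.
move=> /le_trans/(_ H).
rewrite -lee_pdivlMl ?expR_gt0// => /le_trans; apply.
rewrite -EFinM lee_fin -expRN mulrC /c.
by rewrite [X in expR (- X)]mulrAC.
Qed.

End concentration.

(** * Passage to the l_p norm and choice of [a] *)

(** A nonzero deviation contributes its ratio to a set bounded above by norm equivalence, so [sup]
    is a genuine upper bound; at a zero deviation both sides vanish. *)
Lemma is_tau_lpnorm_le (R : realType) (T : completeMetricType R) (k : nat)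
    (nu : probability (borel T) R) (f : T -> 'rV[R]_k) (p : \bar R) (tau : R) x :
  (1 <= p)%E -> is_tau nu f p tau ->
  lpnorm p (f x - mean nu f) <= tau * l2norm (f x - mean nu f).
Proof.
move=> p1 [tau_sup _]; set w := f x - mean nu f.
have [w0|w_neq0] := eqVneq w 0; first by
  rewrite w0 lpnorm0// l2normE big1 ?sqrtr0 ?mulr0// => i _; rewrite mxE expr0n.
have l2_gt0 : 0 < l2norm w.
  by rewrite lt_def l2norm_ge0 andbT; apply: contra_neq w_neq0; exact: l2norm_eq0.
have rx : norm_ratios nu f p (lpnorm p w / l2norm w).
  exists (f x) => //; split; first by exists x.
  by move=> fx; move/eqP: w_neq0; apply; rewrite /w fx subrr.
have [C lpC] := @lpnorm_le_l2norm R k _ p1.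
rewrite -ler_pdivrMr// tau_sup; last by exists (lpnorm p w / l2norm w).
apply: ub_le_sup => //; exists C => _ [y [_ ym] <-].
have y_gt0 : 0 < l2norm (y - mean nu f).
  rewrite lt_def l2norm_ge0 andbT; apply/eqP => /l2norm_eq0/eqP.
  by rewrite subr_eq0 => /eqP.
by rewrite ler_pdivrMr.
Qed.

Theorem mainTheorem2
  (R : realType)
  (T : completeMetricType R) (T_separable : separable T)
  (k : nat) (k_ge1 : (1 <= k)%N)
  (Y : set 'rV[R]_k) (Y_polish : euclidean_polish Y)
  (d : measure_display) (Omega : measurableType d) (P : probability Omega R)
  (X : {RV P >-> borel T})
  (nu : probability (borel T) R) (nu_P1 : P1 nu)
  (X_law : forall A : set (borel T), measurable A -> distribution P X A = nu A)
  (sigma : R) (sigma_gt0 : 0 < sigma)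
  (transport : forall mu : probability (borel T) R, P1 mu ->
     (W1 mu nu <= sqrte ((2 * sigma ^+ 2)%:E * relative_entropy mu nu))%E)
  (p : \bar R) (p_ge1 : (1 <= p)%E) (p_neq2 : p <> 2%:E)
  (eps : R) (eps_gt0 : 0 < eps)
  (veps : R) (veps_gt0 : 0 < veps) (veps_le1 : veps <= 1)
  (f : T -> 'rV[R]_k) (f_Y : forall x, Y (f x))
  (L : R) (L_gt0 : 0 < L) (f_lip : lipschitz_const f L)
  (f_mean : (mean_norm_infty nu f < +oo)%E)
  (tau : R) (tau_p : is_tau nu f p tau) :
  (P [set w | (eps <= lpnorm p (f (X w) - mean nu f))%R]
   <= (Num.min
         ((1 + 2 / veps) ^+ k *
          expR (- (eps ^+ 2 * (1 - veps) ^+ 2 /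
                   (2 * tau ^+ 2 * sigma ^+ 2 * L ^+ 2))))
         (2 `^ (k%:R / 2) *
          expR (- (eps ^+ 2 / (4 * sigma ^+ 2 * tau ^+ 2 * L ^+ 2)))))%:E)%E.
Proof.
pose N (x : borel T) := lpnorm p (f x - mean nu f).
have mcoord := measurable_centered_coord nu L_gt0 f_lip.
have mN : measurable_fun setT N by exact: measurable_lpnorm p_ge1 mcoord.
have m2 : measurable_fun setT (fun x : borel T => l2norm (f x - mean nu f)).
  by apply: measurable_lpnorm mcoord; rewrite lee_fin ler1n.
rewrite -[X in (P X <= _)%E]/(X @^-1` [set x | eps <= N x]).
rewrite -[leLHS]/(distribution P X [set x | eps <= N x]) X_law;
  last exact: measurable_superlevel.
(* If [tau <= 0] every deviation has l_p norm at most 0, so the event is empty; otherwise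
   [eps / tau] is a valid radius. *)
have [tau_gt0|tau_le0] := ltP 0 tau; last first.
  rewrite (_ : [set x | _] = set0); last first.
    apply/seteqP; split => // x /= /(lt_le_trans eps_gt0).
    rewrite ltNge => /negP; apply; apply: le_trans (is_tau_lpnorm_le x p_ge1 tau_p) _.
    by rewrite mulr_le0_ge0 ?l2norm_ge0.
  rewrite measure0 lee_fin le_min; apply/andP; split.
    apply: mulr_ge0 (expR_ge0 _); apply: exprn_ge0.
    by rewrite addr_ge0// divr_ge0// ltW.
  by rewrite mulr_ge0 ?expR_ge0 ?powR_ge0.
have tail a : 0 <= a -> a < 1 ->
    (nu [set x | (eps <= N x)%R] <= ((Num.sqrt (1 - a))^-1 ^+ k *
      expR (- (a * (eps / tau) ^+ 2 / (2 * (sigma * L) ^+ 2))))%:E)%E.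
  move=> a0 a1; have t0 : 0 <= eps / tau by rewrite divr_ge0// ltW.
  apply: le_trans (l2norm_tail nu_P1 sigma_gt0 L_gt0 transport f_lip a0 a1 t0).
  apply: le_measure; rewrite ?inE; [exact: measurable_superlevel..|] => x /= ex.
  by rewrite ler_pdivrMr// mulrC (le_trans ex)// is_tau_lpnorm_le.
rewrite EFin_min le_min; apply/andP; split.
  (* [1 - (1 - veps) ^ 2 = veps (2 - veps) >= (1 + 2 / veps) ^ - 2] *)
  have a0 : 0 <= (1 - veps) ^+ 2 by exact: sqr_ge0.
  have a1 : (1 - veps) ^+ 2 < 1 by nra.
  apply: le_trans (tail _ a0 a1) _; rewrite lee_fin.
  (* With this [a] the exponentials coincide; only the prefactors are compared. *)
  apply: ler_pM; rewrite ?expR_ge0//.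
  - apply: lerXn2r; rewrite ?nnegrE ?invr_ge0 ?sqrtr_ge0//.
      by rewrite addr_ge0// divr_ge0// ltW.
    have c0 : 0 < 1 + 2 / veps by rewrite addr_gt0// divr_gt0.
    rewrite -[leRHS]invrK lef_pV2 ?posrE ?invr_gt0// ?sqrtr_gt0 ?subr_gt0//.
    rewrite -[leLHS]ger0_norm ?invr_ge0 ?(ltW c0)// -sqrtr_sqr ler_wsqrtr//.
    have -> : 1 + 2 / veps = (veps + 2) / veps by field; rewrite gt_eqF.
    rewrite invf_div expr_div_n ler_pdivrMr; last by rewrite exprn_gt0// addr_gt0.
    (* What remains is [veps ^+ 2 <= veps * (2 - veps) * (veps + 2) ^+ 2], true since
       [2 - veps >= 1] and [veps <= 1]. *)
    nra.
  - rewrite ler_expR lerN2 le_eqVlt; apply/orP; left; apply/eqP.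
    by field; rewrite !gt_eqF.
(* Second bound, with [a = 1/2]: here prefactor and exponent both match exactly. *)
have h0 : 0 <= 2^-1 :> R by lra.
have h1 : 2^-1 < 1 :> R by lra.
apply: le_trans (tail _ h0 h1) _; rewrite lee_fin le_eqVlt; apply/orP; left; apply/eqP.
congr (_ * expR (- _)); last by field; rewrite !gt_eqF.
rewrite (_ : 1 - 2^-1 = 2^-1); last by field.
by rewrite mulrC powRrM powR12_sqrt// powR_mulrn ?sqrtr_ge0// sqrtrV// invrK.
Qed.
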